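(* The modular group $Mod(\mathcal{H})$ of the punctured solenoid $\mathcal{H}$ has trivial center.
   Context: Let $\mathbf{D}$ be the unit disk with boundary circle $S^1$; $PSL_2(\mathbb{Z})$ acts on $\mathbf{D}\cup S^1$ by Möbius transformations via the identification $z\mapsto (z-i)/(z+i)$ of the upper half-plane with $\mathbf{D}$. The punctured solenoid $\mathcal{H}$ is the inverse limit of the system of all finite unbranched pointed covers of a punctured surface without boundary and of negative Euler characteristic; its path components are called leaves, and the baseleaf is the leaf containing the basepoint. The baseleaf preserving mapping class group (modular group) $Mod(\mathcal{H})$ is the group of isotopy classes of self-homeomorphisms of $\mathcal{H}$ which preserve the baseleaf and are quasiconformal on leaves. By restriction to the baseleaf (identified with $\mathbf{D}$) and extension to the boundary circle, $Mod(\mathcal{H})$ is identified with the group (under composition) of all orientation-preserving quasisymmetric homeomorphisms $h:S^1\to S^1$ for which there exist finite-index subgroups $K,H<PSL_2(\mathbb{Z})$ with $hKh^{-1}=H$; the statement may be read with this description as the definition of $Mod(\mathcal{H})$. *)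

(* Defs.v *)
From HB Require Import structures.
From mathcomp Require Import all_boot all_order all_algebra.
From mathcomp Require Import complex.
From mathcomp Require Import all_classical all_reals all_analysis.

Set Implicit Arguments.
Unset Strict Implicit.
Unset Printing Implicit Defensive.

Import Order.TTheory GRing.Theory Num.Theory.
Import numFieldNormedType.Exports.

Local Open Scope classical_set_scope.
Local Open Scope ring_scope.

Record homeo (T : topologicalType) := Homeo {
  homeo_fun :> T -> T;
  homeo_inv : T -> T;
  homeoK : cancel homeo_fun homeo_inv;
  homeoVK : cancel homeo_inv homeo_fun;
  homeo_continuous : continuous homeo_fun;
  homeo_inv_continuous : continuous homeo_inv }.

Section HomeoGroup.
Variable T : topologicalType.
Implicit Types f g h : homeo T.

Lemma homeoP f g : f =1 g -> f = g.
Proof.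
case: f g => [f f' fK f'K cf cf'] [g g' gK g'K cg cg'] /= /funext fg.
case: g / fg gK g'K cg => gK g'K cg.
have fg' : f' = g' by apply/funext => x; rewrite -{1}(g'K x) fK.
case: g' / fg' gK g'K cg' => gK g'K cg'.
by congr Homeo; exact: Prop_irrelevance.
Qed.

HB.instance Definition _ := gen_eqMixin (homeo T).
HB.instance Definition _ := gen_choiceMixin (homeo T).

Definition homeo_id : homeo T :=
  Homeo (fun _ => erefl) (fun _ => erefl)
    (fun _ => @cvg_id _ _) (fun _ => @cvg_id _ _).

Definition homeo_sym f : homeo T :=
  Homeo (@homeoVK _ f) (@homeoK _ f)
    (@homeo_inv_continuous _ f) (@homeo_continuous _ f).

Lemma continuousT_comp (f g : T -> T) :
  continuous f -> continuous g -> continuous (f \o g).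
Proof. by move=> cf cg x; apply: continuous_comp; [exact: cg | exact: cf]. Qed.

Definition homeo_comp f g : homeo T :=
  Homeo (can_comp (@homeoK _ f) (@homeoK _ g))
    (can_comp (@homeoVK _ g) (@homeoVK _ f))
    (continuousT_comp (@homeo_continuous _ f) (@homeo_continuous _ g))
    (continuousT_comp (@homeo_inv_continuous _ g)
       (@homeo_inv_continuous _ f)).

Fact homeo_compA : associative homeo_comp.
Proof. by move=> f g h; exact: homeoP. Qed.
Fact homeo_comp1f : left_id homeo_id homeo_comp.
Proof. by move=> f; exact: homeoP. Qed.
Fact homeo_compf1 : right_id homeo_id homeo_comp.
Proof. by move=> f; exact: homeoP. Qed.
Fact homeo_compVf : left_inverse homeo_id homeo_sym homeo_comp.
Proof. by move=> f; apply: homeoP => x; exact: homeoK. Qed.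
Fact homeo_compfV : right_inverse homeo_id homeo_sym homeo_comp.
Proof. by move=> f; apply: homeoP => x; exact: homeoVK. Qed.

(* The group law on [homeo T] is composition: [(f * g)%g x = f (g x)]. *)
HB.instance Definition _ := isGroup.Build (homeo T)
  homeo_compA homeo_comp1f homeo_compf1 homeo_compVf homeo_compfV.

End HomeoGroup.

Section GroupNotions.
Variable G : groupType.
Implicit Types A K : set G.

Definition subgroup_of K A := group_closed [in K] /\ K `<=` A.

(* [A] is covered by finitely many left cosets of [K]. *)
Definition finite_index K A :=
  exists s : seq G, forall a, A a -> exists2 x, x \in s & K (x^-1 * a)%g.

Definition group_center A : set G :=
  [set x | A x /\ forall y, A y -> commute x y].

End GroupNotions.

Section Circle.
Variable R : realType.

(* [R[i]^o] is R[i] with the topology of its norm. *)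
Definition circle : set R[i]^o := [set z | `|z| = 1].

Notation S1 := (set_type circle).

Fact cis_subproof (t : R) : (cos t +i* sin t)%C \in circle.
Proof. by rewrite inE /circle /= normc_def /= cos2Dsin2 sqrtr1. Qed.

Definition cis (t : R) : S1 :=
  exist (fun z => z \in circle) (cos t +i* sin t)%C (cis_subproof t).

Implicit Types (h : homeo S1) (F : R -> R).

Definition circle_lift h F := continuous F /\ forall t, h (cis t) = cis (F t).

Definition orientation_preserving h :=
  exists F, circle_lift h F /\ {homo F : x y / x < y}.

(* A lift [F] of a homeomorphism is strictly monotone, and the image of the arc
   from [cis a] to [cis b], where [a < b <= a + 2 * pi], has length
   [`|F b - F a|]: the ratio compares the image lengths of two adjacent arcs of
   equal length [t]. *)
Definition quasisymmetric h := exists F (M : R),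
  [/\ circle_lift h F, 1 <= M &
    forall x t, 0 < t <= pi ->
      M^-1 <= `|F (x + t) - F x| / `|F x - F (x - t)| <= M].

Definition mx2 (K : nzRingType) (a b c d : K) : 'M[K]_2 :=
  \matrix_(i, j) nth 0 (nth [::] [:: [:: a; b]; [:: c; d]] i) j.

(* The point at infinity is left out: when [A] is real with positive
   determinant, [mobius (cayley_conj A)] below has no pole on the circle. *)
Definition mobius (A : 'M[R[i]]_2) (z : R[i]) : R[i] :=
  (A 0 0 * z + A 0 1) / (A 1 0 * z + A 1 1).

(* The matrix of [z |-> (z - i) / (z + i)]. *)
Definition cayley : 'M[R[i]]_2 := mx2 1 (- 'i%C) 1 'i%C.

Definition cayley_conj (A : 'M[R[i]]_2) : 'M[R[i]]_2 :=
  cayley *m A *m invmx cayley.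

(* PSL_2(Z) acts faithfully on the circle, so it is taken as the group of
   transformations of the circle induced by the matrices in SL_2(Z). *)
Definition PSL2Z : set (homeo S1) :=
  [set f | exists A : 'M[int]_2, \det A = 1 /\
    forall z : S1,
      \val (f z) = mobius (cayley_conj (map_mx intr A)) (\val z)].

Definition PSL2Z_finite_index (K : set (homeo S1)) :=
  subgroup_of K PSL2Z /\ finite_index K PSL2Z.

Definition Mod : set (homeo S1) :=
  [set h | [/\ orientation_preserving h, quasisymmetric h &
    exists K H : set (homeo S1),
      [/\ PSL2Z_finite_index K, PSL2Z_finite_index H &
        [set (h * k * h^-1)%g | k in K] = H]]].

End Circle.

Arguments circle : clear implicits.
Arguments PSL2Z : clear implicits.
Arguments Mod : clear implicits.

(* Main.v *)
(* An element of the center commutes with every parabolic element of PSL_2(Z)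
   (PSL_2(Z) lies in Mod because its elements have bi-Lipschitz lifts), hence
   maps the unique fixed point of each of them to itself.  These fixed points
   are the rational points of the circle, together with infinity; they are
   dense, so the central element is the identity. *)
Require Import Defs.
From mathcomp Require Import all_boot all_order all_algebra.
From mathcomp Require Import complex.
From mathcomp Require Import all_classical all_reals all_analysis.
From mathcomp Require Import ring lra.

Set Implicit Arguments.
Unset Strict Implicit.
Unset Printing Implicit Defensive.

Import Order.TTheory GRing.Theory Num.Theory.
Import numFieldNormedType.Exports.

Local Open Scope classical_set_scope.

Ltac by_components t :=
  apply/eqP; rewrite eq_complex /=; apply/andP; split; apply/eqP; t.

(** Serves twice: for the action of integer matrices on the circle, and for the Cayley
    parametrization of the circle by the real line. *)
Lemma continuous_homography (K : numFieldType) (a b c d : K) (z : K) :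
  (c * z + d != 0 ->
  {for z, continuous (fun z : K => (a * z + b) / (c * z + d) : K)})%R.
Proof.
move=> d0.
have caff (u v : K) : {for z, continuous (fun z : K => u * z + v : K)%R}.
  have cM : {for z, continuous (fun z : K => u * z : K)%R}.
    by apply: (@continuousM K K (fun=> u) id); [exact: cst_continuous | exact: cvg_id].
  by apply: (@continuousD _ _ _ _ (fun=> v) _ cM); exact: cst_continuous.
by apply: (continuousM (caff a b)); apply: continuousV => //; exact: caff.
Qed.

(** * Entrywise computation with 2 by 2 matrices *)

Section Matrix2.
Local Open Scope ring_scope.

Lemma eq_mx2 (K : nzRingType) (M N : 'M[K]_2) :
  M 0 0 = N 0 0 -> M 0 1 = N 0 1 -> M 1 0 = N 1 0 -> M 1 1 = N 1 1 -> M = N.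
Proof.
move=> e00 e01 e10 e11; apply/matrixP => i j.
have I2 k : k = 0 :> 'I_2 \/ k = 1.
  by case: k => [[|[|//]] Hk]; [left | right]; exact: val_inj.
by case: (I2 i) => ->; case: (I2 j) => ->.
Qed.

Lemma mx2_00 (K : nzRingType) (a b c d : K) : mx2 a b c d 0 0 = a.
Proof. by rewrite mxE. Qed.

Lemma mx2_01 (K : nzRingType) (a b c d : K) : mx2 a b c d 0 1 = b.
Proof. by rewrite mxE. Qed.

Lemma mx2_10 (K : nzRingType) (a b c d : K) : mx2 a b c d 1 0 = c.
Proof. by rewrite mxE. Qed.

Lemma mx2_11 (K : nzRingType) (a b c d : K) : mx2 a b c d 1 1 = d.
Proof. by rewrite mxE. Qed.
Definition mx2_ij := (mx2_00, mx2_01, mx2_10, mx2_11).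

Lemma mul_mx2E (K : nzRingType) (M N : 'M[K]_2) i j :
  (M *m N) i j = M i 0 * N 0 j + M i 1 * N 1 j.
Proof.
by rewrite mxE !big_ord_recl big_ord0 addr0; congr (_ + M i _ * N _ j); exact: val_inj.
Qed.

Lemma det_mx2 (K : comNzRingType) (M : 'M[K]_2) :
  \det M = M 0 0 * M 1 1 - M 0 1 * M 1 0.
Proof.
rewrite (expand_det_row _ 0) !big_ord_recl big_ord0 addr0 /cofactor !det_mx11.
rewrite !mxE /= expr0 expr1 mul1r mulN1r mulrN.
by congr (M _ _ * M _ _ - M _ _ * M _ _); exact: val_inj.
Qed.

End Matrix2.

(** * Explicit real lifts of disk automorphisms, with derivative bounds *)

Section Lift.
Local Open Scope ring_scope.
Variable R : realType.
Variables k l : R.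
Hypothesis kl1 : k ^+ 2 + l ^+ 2 < 1.
Implicit Types s t : R.

(* With [z = cis t] and [w = 1 + (k +i* l) * z^*], the lift is an argument of
   [z * w / w^*]; [lift_re] and [lift_im] are the two components of [w]. *)
Definition lift_gap := 1 - (k ^+ 2 + l ^+ 2).
Definition lift_re t := 1 + (k * cos t + l * sin t).
Definition lift_im t := l * cos t - k * sin t.
Definition lift_fun t := t + 2 * atan (lift_im t / lift_re t).

Lemma lift_gap_bounds : 0 < lift_gap <= 1.
Proof.
have := sqr_ge0 k; have := sqr_ge0 l; rewrite /lift_gap => k0 l0.
by apply/andP; split; [rewrite subr_gt0|lra].
Qed.

(** Lagrange's identity bounds the square of [lift_re t - 1] by [1 - lift_gap], and the square root
    of [1 - e] is at most [1 - e / 2]. *)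
Lemma lift_re_ge t : lift_gap / 2 <= lift_re t.
Proof.
have /andP[e0 e1] := lift_gap_bounds.
have : (k * cos t + l * sin t) ^+ 2 <= 1 - lift_gap.
  have -> : 1 - lift_gap = (k * cos t + l * sin t) ^+ 2 + lift_im t ^+ 2.
    transitivity ((k ^+ 2 + l ^+ 2) * (cos t ^+ 2 + sin t ^+ 2)).
      by rewrite cos2Dsin2 /lift_gap; ring.
    by rewrite /lift_im; ring.
  by rewrite lerDl sqr_ge0.
rewrite /lift_re; set w := _ + _ => w2; nra.
Qed.

Lemma lift_re_gt0 t : 0 < lift_re t.
Proof. have /andP[e0 e1] := lift_gap_bounds; have := lift_re_ge t; lra. Qed.

Lemma lift_norm t : lift_re t ^+ 2 + lift_im t ^+ 2 = 2 * lift_re t - lift_gap.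
Proof.
transitivity (2 * lift_re t - 1 + (k ^+ 2 + l ^+ 2) * (cos t ^+ 2 + sin t ^+ 2)).
  by rewrite /lift_re /lift_im; ring.
by rewrite cos2Dsin2 /lift_gap; ring.
Qed.

Lemma lift_re_derive t : is_derive t 1 lift_re (lift_im t).
Proof.
rewrite /lift_re /lift_im; apply: is_derive_eq.
by rewrite -![_ *: _]/(_ * _); ring.
Qed.

Lemma lift_im_derive t : is_derive t 1 lift_im (1 - lift_re t).
Proof.
rewrite /lift_re /lift_im; apply: is_derive_eq.
by rewrite -![_ *: _]/(_ * _); ring.
Qed.

(** The derivative is a Poisson kernel: it equals [(1 - |a|^2) / |z + a|^2] for [a = k +i* l] and
    [z = cis t]. *)
Lemma lift_fun_derive t :
  is_derive t 1 lift_fun (lift_gap / (lift_re t ^+ 2 + lift_im t ^+ 2)).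
Proof.
have dre := lift_re_derive t; have dim := lift_im_derive t.
have re0 := lift_re_gt0 t.
have dV : is_derive t 1 (fun s => (lift_re s)^-1) (- (lift_re t)^-2 * lift_im t).
  by apply: is_deriveV; rewrite gt_eqF.
have dq := is_deriveM dim dV.
have dat := is_derive1_comp (is_derive1_atan _) dq.
(* Eliminating the gap through [lift_norm] leaves a rational identity in the two components of [w]
   alone. *)
have -> : lift_gap = 2 * lift_re t - (lift_re t ^+ 2 + lift_im t ^+ 2).
  by rewrite lift_norm; ring.
rewrite /lift_fun; apply: is_derive_eq.
rewrite -![_ *: _]/(_ * _) -[(_ * _) t]/(lift_im t / lift_re t).
set P := lift_re t in re0 *; set Q := lift_im t.
have PQ : P ^+ 2 + Q ^+ 2 != 0 by rewrite gt_eqF // ltr_pwDl ?exprn_gt0 ?sqr_ge0.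
by field; rewrite PQ lt0r_neq0.
Qed.

(** The denominator [n] satisfies [lift_re t ^+ 2 <= n <= 2 * lift_re t], whence [lift_re t <= 2]
    and [n <= 4]; squaring [lift_re_ge] bounds [n] from below. *)
Lemma lift_derive_bounds t :
  lift_gap / 4 <= lift_gap / (lift_re t ^+ 2 + lift_im t ^+ 2) <= 4 / lift_gap.
Proof.
have /andP[e0 e1] := lift_gap_bounds; have re_ge := lift_re_ge t.
set n := _ + _ ^+ 2.
have n0 : 0 < n by rewrite ltr_pwDl ?exprn_gt0 ?lift_re_gt0 ?sqr_ge0.
have n4 : n <= 4.
  have : lift_re t ^+ 2 <= n by rewrite lerDl sqr_ge0.
  rewrite /n lift_norm; nra.
have ne : lift_gap ^+ 2 / 4 <= n.
  have : lift_re t ^+ 2 <= n by rewrite lerDl sqr_ge0.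
  nra.
rewrite ler_pM2l // lef_pV2 ?posrE // n4 /= ler_pdivrMr // mulrAC ler_pdivlMr //.
nra.
Qed.

Lemma lift_fun_continuous : continuous lift_fun.
Proof.
move=> t; have [? _] := lift_fun_derive t.
by apply: differentiable_continuous; apply/derivable1_diffP.
Qed.

Lemma lift_fun_bilipschitz s t : s <= t ->
  lift_gap / 4 * (t - s) <= lift_fun t - lift_fun s <= 4 / lift_gap * (t - s).
Proof.
move=> st.
have [|x _ ->] := MVT_segment st (fun x _ => lift_fun_derive x).
  exact/continuous_subspaceT/lift_fun_continuous.
have /andP[lo hi] := lift_derive_bounds x.
by rewrite !ler_wpM2r ?subr_ge0.
Qed.
End Lift.

(** * The action of SL_2(Z) on the circle through SU(1,1) *)

Section Circle.
Local Open Scope ring_scope.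
Variable R : realType.
Notation S1 := (set_type (circle R)).
Implicit Types (A B : 'M[int]_2) (p q : int) (z w : R[i]).
Implicit Types (f g h : homeo S1) (F : R -> R).

Lemma conjcD z w : (z + w)^*%C = z^*%C + w^*%C.
Proof. exact: (rmorphD conjc). Qed.

Lemma conjcM z w : (z * w)^*%C = z^*%C * w^*%C.
Proof. exact: (rmorphM conjc). Qed.

Lemma circleP (z : S1) : \val z * (\val z)^*%C = 1 :> R[i].
Proof.
case: z => z /=; rewrite inE /circle /= => nz.
by rewrite -sqr_normc nz expr1n.
Qed.

Lemma in_circle z : z * z^*%C = 1 -> z \in circle R.
Proof.
move=> zz; rewrite inE /circle /=; apply/eqP.
by rewrite -(@eqrXn2 _ 2) ?ler01 ?normr_ge0// sqr_normc zz expr1n.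
Qed.

Lemma cayley_unit : cayley R \in unitmx.
Proof.
suff /mulmx1_unit[] : cayley R *m
   (mx2 (2^-1)%:C (2^-1)%:C (0 +i* 2^-1) (0 -i* 2^-1))%C = 1%:M by [].
apply: eq_mx2; rewrite mul_mx2E !mx2_ij !mxE; by_components ltac:(lra).
Qed.

(* Conjugation by the Cayley matrix carries SL_2(R) to SU(1,1). *)
Definition su_alpha A : R[i] :=
  (((A 0 0)%:~R + (A 1 1)%:~R) / 2 +i* (((A 0 1)%:~R - (A 1 0)%:~R) / 2))%C.
Definition su_beta A : R[i] :=
  (((A 0 0)%:~R - (A 1 1)%:~R) / 2 -i* (((A 0 1)%:~R + (A 1 0)%:~R) / 2))%C.
Definition su_mx A : 'M[R[i]]_2 :=
  mx2 (su_alpha A) (su_beta A) (su_beta A)^*%C (su_alpha A)^*%C.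

Lemma cayley_conjE A : cayley_conj (map_mx intr A) = su_mx A.
Proof.
rewrite /cayley_conj; apply: (canLR (mulmxK cayley_unit)).
apply: eq_mx2; rewrite !mul_mx2E !mx2_ij !mxE -!(rmorph_int (real_complex R));
  by_components ltac:(lra).
Qed.

Lemma cayley_conjM (M N : 'M[R[i]]_2) :
  cayley_conj (M *m N) = cayley_conj M *m cayley_conj N.
Proof. by rewrite /cayley_conj !mulmxA mulmxKV // cayley_unit. Qed.

Lemma su_norm A : \det A = 1 ->
  su_alpha A * (su_alpha A)^*%C - su_beta A * (su_beta A)^*%C = 1.
Proof.
rewrite det_mx2 => /(congr1 (intr : int -> R)).
rewrite rmorphB !rmorphM rmorph1 /= => dA.
transitivity (((A 0 0)%:~R * (A 1 1)%:~R - (A 0 1)%:~R * (A 1 0)%:~R : R)%:C)%C.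
  by_components ltac:(by field).
by rewrite dA.
Qed.

Definition su_num A z := su_alpha A * z + su_beta A.
Definition su_den A z := (su_beta A)^*%C * z + (su_alpha A)^*%C.

Lemma mobiusE A z : mobius (cayley_conj (map_mx intr A)) z = su_num A z / su_den A z.
Proof. by rewrite cayley_conjE /mobius !mx2_ij. Qed.

(** Since [z^*] is the inverse of [z], numerator and denominator have equal modulus, so the quotient
    stays on the circle. *)
Lemma su_numE A z : z * z^*%C = 1 -> su_num A z = z * (su_den A z)^*%C.
Proof.
move=> zz; rewrite /su_den /su_num conjcD conjcM !conjcK mulrDr mulrCA zz; ring.
Qed.

Lemma su_den_neq0 A z : \det A = 1 -> z * z^*%C = 1 -> su_den A z != 0.
Proof.
move=> /su_norm dA zz; apply/eqP => D0.
have N0 : su_num A z = 0 by rewrite su_numE // D0 conjc0 mulr0.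
suff z0 : z = 0 by move: zz; rewrite z0 mul0r => /esym/eqP; rewrite oner_eq0.
(* Cramer's rule for the linear forms [su_num] and [su_den], whose determinant is 1 by [su_norm]. *)
have -> : z = (su_alpha A)^*%C * su_num A z - su_beta A * su_den A z.
  by rewrite -[LHS]mul1r -dA /su_num /su_den; ring.
by rewrite N0 D0 !mulr0 subrr.
Qed.

Lemma mobius_circle A z : \det A = 1 -> z * z^*%C = 1 ->
  mobius (cayley_conj (map_mx intr A)) z \in circle R.
Proof.
move=> dA zz; rewrite mobiusE; apply: in_circle.
have D0 := su_den_neq0 dA zz.
have D0' : (su_den A z)^*%C != 0 by rewrite conjc_eq0.
rewrite su_numE // !conjcM conjcK conjc_inv.
transitivity (z * z^*%C); last by [].
by field; apply/andP.
Qed.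

(** Only the pole of [N] has to be avoided: if the outer denominator vanishes, both sides are
    quotients by zero, hence 0. *)
Lemma mobiusM (M N : 'M[R[i]]_2) z : N 1 0 * z + N 1 1 != 0 ->
  mobius (M *m N) z = mobius M (mobius N z).
Proof.
rewrite /mobius !mul_mx2E => d0.
set n := N 0 0 * z + N 0 1; set d := N 1 0 * z + N 1 1 in d0 *.
have E i : M i 0 * (n / d) + M i 1 = (M i 0 * n + M i 1 * d) / d by field.
rewrite !E invf_div mulrA divfK //; congr (_ / _); rewrite /n /d; ring.
Qed.

Lemma mobius_slM A B z : \det B = 1 -> z * z^*%C = 1 ->
  mobius (cayley_conj (map_mx intr (A *m B))) z =
  mobius (cayley_conj (map_mx intr A)) (mobius (cayley_conj (map_mx intr B)) z).
Proof.
move=> dB zz; rewrite map_mxM cayley_conjM mobiusM // cayley_conjE !mx2_ij.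
exact: su_den_neq0.
Qed.

Lemma mobius_sl1 z : mobius (cayley_conj (map_mx intr (1%:M : 'M[int]_2))) z = z.
Proof.
rewrite map_mx1 /cayley_conj mulmx1 mulmxV ?cayley_unit // /mobius !mxE /=.
by rewrite mul1r mul0r addr0 add0r divr1.
Qed.

(** For determinant 1 the adjugate is an integral inverse; it will induce the inverse
    homeomorphism. *)
Lemma det_adj2 A : \det A = 1 -> \det (\adj A) = 1.
Proof.
by move=> dA; rewrite -[LHS]mul1r -dA -det_mulmx mul_mx_adj dA det1.
Qed.

Definition sl_act A (dA : \det A = 1) (z : S1) : S1 :=
  exist (fun z => z \in circle R) _ (mobius_circle dA (circleP z)).

Lemma sl_actM A B (dA : \det A = 1) (dB : \det B = 1) (z : S1) :
  A *m B = 1%:M -> sl_act dA (sl_act dB z) = z.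
Proof.
by move=> AB; apply: val_inj; rewrite /= -mobius_slM ?circleP // AB mobius_sl1.
Qed.

(** The circle carries the initial topology of its inclusion, so continuity can be tested in the
    complex plane. *)
Lemma continuous_circle (T : topologicalType) (g : T -> S1) :
  continuous (fun x => \val (g x) : R[i]^o) -> continuous g.
Proof. by move=> cg; apply: continuous_comp_initial. Qed.

Lemma sl_act_continuous A (dA : \det A = 1) : continuous (sl_act dA).
Proof.
apply: continuous_circle => z.
rewrite /continuous_at /= mobiusE (_ : (fun x => _) =
   (fun x : S1 => su_num A (\val x) / su_den A (\val x) : R[i]^o)).
  2: by apply/funext => x; rewrite mobiusE.
apply: (continuous_comp (f := \val : S1 -> R[i]^o)
   (g := fun z : R[i]^o => su_num A z / su_den A z : R[i]^o)).
  exact: (@initial_continuous S1 (R[i]^o) set_val).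
apply: (@continuous_homography R[i] (su_alpha A) (su_beta A)).
by apply: su_den_neq0; rewrite ?circleP.
Qed.

Lemma sl_actK A (dA : \det A = 1) :
  cancel (sl_act dA) (sl_act (det_adj2 dA)).
Proof. by move=> z; apply: sl_actM; rewrite mul_adj_mx dA. Qed.

Lemma sl_actVK A (dA : \det A = 1) :
  cancel (sl_act (det_adj2 dA)) (sl_act dA).
Proof. by move=> z; apply: sl_actM; rewrite mul_mx_adj dA. Qed.

Definition sl_homeo A (dA : \det A = 1) : homeo S1 :=
  Homeo (sl_actK dA) (sl_actVK dA)
    (@sl_act_continuous _ dA) (@sl_act_continuous _ (det_adj2 dA)).

Lemma PSL2Z_sl A (dA : \det A = 1) : PSL2Z R (sl_homeo dA).
Proof. exists A; split; [exact: dA | move=> z; exact: erefl]. Qed.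

(** * The group structure of PSL_2(Z) *)

Lemma PSL2Z1 : PSL2Z R 1%g.
Proof. by exists 1%:M; split; [exact: det1 | move=> z; rewrite mobius_sl1]. Qed.

Lemma PSL2ZM f g : PSL2Z R f -> PSL2Z R g -> PSL2Z R (f * g)%g.
Proof.
move=> [A [dA fA]] [B [dB gB]]; exists (A *m B); split.
  by rewrite det_mulmx dA dB mulr1.
by move=> z; rewrite mobius_slM ?circleP // -gB -fA.
Qed.

Lemma PSL2ZV f : PSL2Z R f -> PSL2Z R f^-1%g.
Proof.
move=> [A [dA fA]]; exists (\adj A); split; first exact: det_adj2.
move=> z; rewrite -{2}(@homeoVK _ f z) fA -mobius_slM ?circleP //.
by rewrite mul_adj_mx dA mobius_sl1.
Qed.

Lemma PSL2Z_self_finite_index : PSL2Z_finite_index (PSL2Z R).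
Proof.
split; last first.
  by exists [:: 1%g] => f Pf; exists 1%g; rewrite ?mem_seq1 // invg1 mul1g.
split=> //; split; first by rewrite inE; exact: PSL2Z1.
move=> f g; rewrite !inE => Pf Pg; apply: PSL2ZM => //; exact: PSL2ZV.
Qed.

Lemma PSL2Z_conj h : PSL2Z R h -> [set (h * k * h^-1)%g | k in PSL2Z R] = PSL2Z R.
Proof.
move=> Ph; apply/seteqP; split=> [_ [k Pk <-]|k Pk].
  by apply: PSL2ZM; [exact: PSL2ZM | exact: PSL2ZV].
exists (h^-1 * k * h)%g; last by rewrite !mulgA mulgV mul1g mulgK.
by apply: PSL2ZM => //; apply: PSL2ZM => //; exact: PSL2ZV.
Qed.

(** * Bi-Lipschitz lifts and the inclusion of PSL_2(Z) in [Mod] *)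

Lemma bilipschitz_orientation_preserving h F (m M : R) : 0 < m ->
  circle_lift h F ->
  (forall x y, x <= y -> m * (y - x) <= F y - F x <= M * (y - x)) ->
  orientation_preserving h.
Proof.
move=> m0 hF bl; exists F; split=> // x y xy.
rewrite -subr_gt0; have /andP[+ _] := bl _ _ (ltW xy).
by apply: lt_le_trans; rewrite mulr_gt0 // subr_gt0.
Qed.

(** Both increments of [F] lie between [m * t] and [M * t], so their ratio lies between [m / M] and
    [M / m]. *)
Lemma bilipschitz_quasisymmetric h F (m M : R) : 0 < m ->
  circle_lift h F ->
  (forall x y, x <= y -> m * (y - x) <= F y - F x <= M * (y - x)) ->
  quasisymmetric h.
Proof.
move=> m0 hF bl; have mM : m <= M.
  by have := bl _ _ (@ler01 R); rewrite subr0 !mulr1 => /andP[]; exact: le_trans.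
have M0 : 0 < M := lt_le_trans m0 mM.
exists F, (M / m); split=> //; first by rewrite ler_pdivlMr // mul1r.
move=> x t /andP[t0 _].
have := bl x (x + t); have := bl (x - t) x; rewrite lerDl gerBl ltW // addrAC subrr add0r.
rewrite opprB addrCA subrr addr0.
move=> /(_ isT)/andP[a1 a2] /(_ isT)/andP[b1 b2].
have mt0 : 0 < m * t by rewrite mulr_gt0.
rewrite !gtr0_norm; [|exact: lt_le_trans a1|exact: lt_le_trans b1].
have a0 := lt_le_trans mt0 a1.
rewrite invf_div ler_pdivlMr // ler_pdivrMr //.
rewrite mulrAC ler_pdivrMr // mulrAC ler_pdivlMr //.
apply/andP; split.
  apply: (@le_trans _ _ (m * (M * t))); first by rewrite ler_pM2l.
  by rewrite mulrCA [X in _ <= X]mulrC ler_pM2l.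
apply: (@le_trans _ _ (M * t * m)); first by rewrite ler_pM2r.
by rewrite -mulrA [t * m]mulrC ler_pM2l.
Qed.

Lemma cisD (s t : R) : \val (cis (s + t)) = \val (cis s) * \val (cis t) :> R[i].
Proof. by rewrite /= cosD sinD; simpc; congr Complex; ring. Qed.

Lemma cis_surj z : z * z^*%C = 1 -> exists t : R, \val (cis t) = z.
Proof.
case: z => a b /=; simpc => -[] ab _.
have a1 : -1 <= a <= 1 by apply/andP; split; nra.
have [/andP[t0 tpi] ct] := acos_def a1.
have sb : sin (acos a) = `|b|.
  rewrite sin_acos // -(sqrtr_sqr b); congr Num.sqrt.
  by rewrite -ab; ring.
have [b0|b0] := leP 0 b.
  by exists (acos a); rewrite ct sb ger0_norm.
by exists (- acos a); rewrite cosN sinN ct sb ltr0_norm // opprK.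
Qed.

Lemma cis_2atan (u : R) :
  \val (cis (2 * atan u)) * (1 -i* u)%C = (1 +i* u)%C :> R[i].
Proof.
have u2 : 0 < 1 + u ^+ 2 by rewrite ltr_pwDl ?sqr_ge0.
have c2 : cos (atan u) ^+ 2 = (1 + u ^+ 2)^-1.
  by rewrite cos_atan exprVn sqr_sqrtr // ltW.
have sc : sin (atan u) = u * cos (atan u).
  have := atanK u; rewrite /tan => tu; rewrite -[X in _ = X * _]tu divfK //.
  by rewrite cos_atan invr_eq0 sqrtr_eq0 -ltNge.
rewrite mulr_natl mulr2n cisD /= sc; set c := cos _ in c2 *.
have {}c2 : c * c * (1 + u * u) = 1 by rewrite -!expr2 c2 mulVf // gt_eqF.
apply/eqP; rewrite eq_complex /=; apply/andP; split; apply/eqP.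
  by rewrite -[RHS]c2; ring.
by transitivity (u * (c * c * (1 + u * u))); [ring | rewrite c2 mulr1].
Qed.

(** In the right half-plane [atan (y / x)] is an argument of [w = x +i* y], so twice it is an
    argument of [w / w^*]; the real factor [x] reduces this to [cis_2atan]. *)
Lemma cis_2atan_div (x y : R) : 0 < x ->
  \val (cis (2 * atan (y / x))) * (x -i* y)%C = (x +i* y)%C :> R[i].
Proof.
move=> x0; have E : x%:C%C * (1 +i* (y / x))%C = (x +i* y)%C.
  by simpc; rewrite mulrCA divff ?gt_eqF ?mulr1.
have E' : x%:C%C * (1 -i* (y / x))%C = (x -i* y)%C.
  by simpc; rewrite mulrCA divff ?gt_eqF ?mulr1.
by rewrite -E -E' mulrCA cis_2atan.
Qed.

(** Dividing [su_norm] by the squared modulus of [su_alpha A] puts the ratio [k +i* l] in the open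
    unit disk, as the lifts require. *)
Lemma su_ratio A : \det A = 1 -> su_alpha A != 0 /\ exists k l : R,
  k ^+ 2 + l ^+ 2 < 1 /\ su_beta A = su_alpha A * (k +i* l)%C.
Proof.
move=> /(@su_norm A); move: (su_alpha A) (su_beta A) => a b nab.
have a0 : a != 0.
  apply/eqP => a0; move: nab; rewrite a0 mul0r sub0r -sqr_normc => /eqP.
  by rewrite eqr_oppLR => /eqP nb; have := exprn_ge0 2 (normr_ge0 b); rewrite nb ler0N1.
split=> //; have [k [l kl]] : exists k l, b / a = Complex k l.
  by case: (b / a) => k l; exists k; exists l.
have ba : b = a * (k +i* l)%C by rewrite -kl mulrC divfK.
exists k, l; split=> //; move: nab; rewrite ba; case: (a) => x y [E _].
have {}E : (x ^+ 2 + y ^+ 2) * (1 - (k ^+ 2 + l ^+ 2)) = 1 by rewrite -[RHS]E; ring.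
rewrite -subr_gt0 -(@pmulr_rgt0 _ (x ^+ 2 + y ^+ 2)) ?E //.
rewrite lt_def addr_ge0 ?sqr_ge0 // andbT; apply/eqP => xy.
by move: E; rewrite xy mul0r => /esym/eqP; rewrite oner_eq0.
Qed.

Lemma lift_cis (k l t : R) :
  (1 + (k +i* l) * (\val (cis t))^*)%C = (lift_re k l t +i* lift_im k l t)%C.
Proof. by rewrite /lift_re /lift_im; simpc; congr Complex; ring. Qed.

Lemma sl_lift h A : \det A = 1 ->
  (forall z : S1, \val (h z) = mobius (cayley_conj (map_mx intr A)) (\val z)) ->
  exists c k l : R, k ^+ 2 + l ^+ 2 < 1 /\ circle_lift h (fun t => c + lift_fun k l t).
Proof.
move=> dA hA; have [a0 [k [l [kl ba]]]] := su_ratio dA.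
have a0' : (su_alpha A)^*%C != 0 by rewrite conjc_eq0.
have [c cE] : exists t, \val (cis t) = su_alpha A / (su_alpha A)^*%C.
  apply: cis_surj; rewrite conjcM conjc_inv conjcK; field.
  by rewrite a0.
exists c, k, l; split=> //; split.
  move=> t; apply: (@cvgD R R^o); [exact: cvg_cst | exact: lift_fun_continuous].
move=> t; apply: val_inj; rewrite hA mobiusE su_numE ?circleP //.
rewrite /lift_fun cisD cE cisD.
have re0 := lift_re_gt0 kl t.
have := cis_2atan_div (lift_im k l t) re0.
set v := \val (cis (2 * _)).
set p := lift_re _ _ _ in re0 *; set q := lift_im _ _ _ => vE.
(* With [w = p +i* q], the denominator is the conjugate of [su_alpha A * w]. *)
have dE : su_den A (\val (cis t)) = (su_alpha A)^*%C * (p -i* q)%C.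
  rewrite /su_den ba conjcM mulrC.
  have -> : (p -i* q)%C = ((p +i* q)%C)^*%C by [].
  rewrite -lift_cis conjcD conjcM conjcK conjc1; ring.
have d0 := su_den_neq0 dA (circleP (cis t)).
rewrite dE conjcM conjcK in d0 *.
have -> : (p -i* q)%C^*%C = (p +i* q)%C :> R[i] by rewrite /= opprK.
rewrite -vE; move: d0; rewrite mulf_eq0 negb_or => /andP[_ d0].
by field; apply/andP.
Qed.

(** The explicit lift is bi-Lipschitz, which gives the first two conditions; for the third, [h]
    normalizes PSL_2(Z), so both finite-index subgroups can be PSL_2(Z) itself. *)
Lemma PSL2Z_Mod h : PSL2Z R h -> Mod R h.
Proof.
move=> Ph; have [A [dA hA]] := Ph; have [c [k [l [kl hF]]]] := sl_lift dA hA.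
have /andP[e0 _] := lift_gap_bounds kl.
have m0 : 0 < lift_gap k l / 4 by rewrite divr_gt0.
have bl x y : x <= y ->
    lift_gap k l / 4 * (y - x) <= (c + lift_fun k l y) - (c + lift_fun k l x) <=
    4 / lift_gap k l * (y - x).
  by move=> xy; rewrite opprD addrACA subrr add0r lift_fun_bilipschitz.
split.
- exact: bilipschitz_orientation_preserving m0 hF bl.
- exact: bilipschitz_quasisymmetric m0 hF bl.
- exists (PSL2Z R), (PSL2Z R); split; [| |exact: PSL2Z_conj];
  exact: PSL2Z_self_finite_index.
Qed.

(** * Parabolic elements and their fixed points *)

(** The identity plus the column [(p, q)] times the row [(- q, p)]. It fixes the vector [(p, q)],
    hence, unless that vector is zero, the boundary point [p / q], with infinity written [1 / 0]. *)
Definition parabolic p q : 'M[int]_2 :=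
  mx2 (1 - p * q) (p ^+ 2) (- q ^+ 2) (1 + p * q).

Lemma det_parabolic p q : \det (parabolic p q) = 1.
Proof. by rewrite det_mx2 !mx2_ij; ring. Qed.

(** The quadratic whose roots are the fixed points is a perfect square up to a constant, which makes
    the fixed point unique when [(p, q)] is nonzero. *)
Lemma parabolic_num_den p q z :
  su_num (parabolic p q) z - z * su_den (parabolic p q) z =
  (0 -i* 2^-1)%C * ((p%:~R +i* q%:~R)%C * z - (p%:~R -i* q%:~R)%C) ^+ 2.
Proof.
case: z => x y; rewrite /su_num /su_den /su_alpha /su_beta !mx2_ij.
rewrite !(rmorphD, rmorphB, rmorphN, rmorphXn, rmorphM, rmorph1) /=.
set P : R := p%:~R; set Q : R := q%:~R.
by rewrite expr2; by_components ltac:(field).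
Qed.

Lemma parabolic_fixed p q (z : S1) :
  (mobius (cayley_conj (map_mx intr (parabolic p q))) (\val z) = \val z) <->
  (p%:~R +i* q%:~R)%C * \val z = (p%:~R -i* q%:~R)%C :> R[i].
Proof.
have d0 := su_den_neq0 (det_parabolic p q) (circleP z).
have E := parabolic_num_den p q (\val z).
have i2 : (0 -i* 2^-1)%C != 0 :> R[i].
  by rewrite eq_complex /= eqxx /= oppr_eq0 invr_eq0 pnatr_eq0.
rewrite mobiusE; split=> [fz|zE].
  apply/eqP; rewrite -subr_eq0 -sqrf_eq0 -(mulrI_eq0 _ (mulfI i2)).
  by rewrite -E subr_eq0 -[in X in _ == X * _]fz mulfVK.
apply: (canLR (mulfK d0)); apply/eqP.
by rewrite -subr_eq0 E zE subrr expr0n mulr0.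
Qed.

(** A commuting [f] sends fixed points of the parabolic element to fixed points, and there is only
    one; nonvanishing of [(p, q)] allows [p +i* q] to be cancelled. *)
Lemma PSL2Z_centralizer_fixes f p q (z : S1) :
  (forall g, PSL2Z R g -> commute f g) -> (p, q) != (0, 0) ->
  (p%:~R +i* q%:~R)%C * \val z = (p%:~R -i* q%:~R)%C :> R[i] -> f z = z.
Proof.
move=> cf pq zE; pose g := sl_homeo (det_parabolic p q).
have gz : g z = z by apply: val_inj; apply/parabolic_fixed.
have gfz : g (f z) = f z.
  by rewrite -[in RHS]gz -[LHS]/((g * f)%g z) -cf //; exact: PSL2Z_sl.
have fzE := (parabolic_fixed p q (f z)).1 (congr1 \val gfz).
apply/val_inj/(@mulfI _ (p%:~R +i* q%:~R)%C); last by rewrite zE fzE.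
by rewrite eq_complex /= !intr_eq0 -xpair_eqE.
Qed.

(** * The Cayley image of the real line and density of its rational points *)

Lemma addi_neq0 (x : R) : (x +i* 1)%C != 0 :> R[i].
Proof. by rewrite eq_complex /= oner_eq0 andbF. Qed.

Fact of_real_subproof (x : R) : (x -i* 1)%C / (x +i* 1)%C \in circle R.
Proof.
apply: in_circle; rewrite conjcM conjc_inv.
have -> : (x -i* 1)%C^*%C = (x +i* 1)%C :> R[i] by rewrite /= opprK.
have -> : (x +i* 1)%C^*%C = (x -i* 1)%C :> R[i] by [].
field; rewrite addi_neq0 andbT.
by rewrite eq_complex /= oppr_eq0 oner_eq0 andbF.
Qed.

(** The Cayley transform on the real line; the point 1 of the circle, image of infinity, is
    missed. *)
Definition of_real (x : R) : S1 :=
  exist (fun z => z \in circle R) _ (of_real_subproof x).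

Lemma of_realE (x : R) : \val (of_real x) * (x +i* 1)%C = (x -i* 1)%C :> R[i].
Proof. by rewrite /= mulfVK // addi_neq0. Qed.

Lemma of_real_surj (z : S1) : \val z != 1 :> R[i] -> exists x, z = of_real x.
Proof.
have := circleP z; case E : (\val z) => [a b] [ab _].
rewrite eq_complex /= negb_and => ab1.
have a1 : a - 1 != 0.
  apply/eqP => a1; have {}a1 : a = 1 by rewrite -[a](subrK 1) a1 add0r.
  move: ab1; rewrite a1 eqxx /= => /eqP; apply; apply/eqP.
  by rewrite -sqrf_eq0 expr2; apply/eqP; move: ab; rewrite a1; lra.
(* Solving [z = (x - i) / (x + i)] gives [x = i * (1 + z) / (1 - z)], which is [b / (a - 1)] when
   [z] has modulus 1. *)
exists (b / (a - 1)); apply/val_inj/(mulIf (addi_neq0 (b / (a - 1)))).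
rewrite of_realE E; have : b / (a - 1) * (a - 1) = b by rewrite divfK.
set x := b / (a - 1) => xE; apply/eqP; rewrite eq_complex /= !mulr1.
apply/andP; split; apply/eqP; first by rewrite -[in X in _ - X]xE; ring.
apply: (mulfI a1); transitivity (a * a - a + b * (x * (a - 1))); first by ring.
by rewrite xE; move: ab; lra.
Qed.

Lemma normc_real (x : R) : `|x%:C%C| = `|x|%:C%C :> R[i].
Proof. by rewrite normc_def /= expr0n addr0 sqrtr_sqr. Qed.

Lemma real_complex_continuous : continuous (fun x : R => x%:C%C : R[i]^o).
Proof.
move=> x; apply/(@cvgrPdist_lt _ R[i]^o) => -[e e'] ee.
(* A positive element of [R[i]] is real. *)
have [-> e0] : e' = 0 /\ 0 < e by move: ee; rewrite ltcE /= => /andP[/eqP].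
have xe : \forall y \near x, `|x - y| < e by exact: (@nbhsx_ballx R R x e e0).
apply: filterS xe => y xy.
by rewrite -(rmorphB (real_complex R)) normc_real ltcR.
Qed.

Lemma of_real_continuous : continuous of_real.
Proof.
apply: continuous_circle => x.
rewrite (_ : (fun x => _) =
    (fun x : R => (1 * x%:C%C + (0 -i* 1)%C) / (1 * x%:C%C + 'i%C) : R[i]^o)); last first.
  by apply/funext => y /=; rewrite !mul1r; simpc.
apply: (continuous_comp (f := (fun x : R => x%:C%C : R[i]^o))
   (g := fun z : R[i]^o => (1 * z + (0 -i* 1)%C) / (1 * z + 'i%C) : R[i]^o)).
  exact: real_complex_continuous.
apply: (@continuous_homography R[i]).
by rewrite mul1r; simpc; exact: addi_neq0.
Qed.

(** The parameters of points moved by [f] form an open set, which would contain a rational if it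
    were nonempty. *)
Lemma dense_fixed f : (forall x : rat, f (of_real (ratr x)) = of_real (ratr x)) ->
  forall x : R, f (of_real x) = of_real x.
Proof.
move=> fQ x0; apply/eqP; apply: contraT => fx0.
pose g (x : R) : R[i]^o := \val (f (of_real x)) - \val (of_real x).
have cval : continuous (\val : S1 -> R[i]^o).
  exact: (@initial_continuous S1 (R[i]^o) set_val).
have cu : continuous (fun x : R => \val (f (of_real x)) : R[i]^o).
  move=> x; apply: (continuous_comp (f := f \o of_real) (g := \val : S1 -> R[i]^o));
    last exact: cval.
  by apply: continuous_comp; [exact: of_real_continuous | exact: homeo_continuous].
have cv : continuous (fun x : R => \val (of_real x) : R[i]^o).
  move=> x; apply: (continuous_comp (g := \val : S1 -> R[i]^o)).
    exact: of_real_continuous.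
  exact: cval.
have cg : continuous g.
  by move=> x; exact: (@continuousB _ R[i]^o _ _ _ _ (cu x) (cv x)).
have og : open (g @^-1` (~` [set 0])).
  apply: open_comp => [x _|]; first exact: cg.
  apply: closed_openC; apply: accessible_closed_set1; apply: hausdorff_accessible.
  exact: (@norm_hausdorff _ R[i]^o).
have [] := dense_rat _ og.
  exists x0 => /= /eqP; rewrite subr_eq0 => /eqP /val_inj; exact/eqP.
by move=> x [gx [q _ qx]]; case: gx; rewrite /g -qx /= fQ subrr.
Qed.

Lemma PSL2Z_centralizer_trivial f : (forall g, PSL2Z R g -> commute f g) -> f = 1%g.
Proof.
move=> cf; apply: homeoP => z.
have [z1|/of_real_surj[x ->]] := eqVneq (\val z : R[i]) 1.
  (* The point 1 is the image of infinity, that is, of [1 / 0]. *)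
  apply: (PSL2Z_centralizer_fixes (p := 1) (q := 0)) => //.
  by rewrite z1; by_components ltac:(rewrite /=; ring).
apply: dense_fixed => {x} -q.
apply: (PSL2Z_centralizer_fixes (p := numq q) (q := denq q)) => //.
  by rewrite xpair_eqE denq_eq0 andbF.
(* Factoring out the denominator of [q] reduces the equation to [of_realE]. *)
have -> : (((numq q)%:~R : R) +i* (denq q)%:~R)%C =
    (denq q)%:~R%:C%C * (ratr q +i* 1)%C.
  by simpc; rewrite mulrC divfK // intr_eq0 denq_eq0.
rewrite -mulrA [X in _ * X]mulrC of_realE.
by simpc; rewrite mulrC divfK // intr_eq0 denq_eq0.
Qed.

End Circle.

Theorem theorem5p1 (R : realType) : group_center (Mod R) = [set 1%g].
Proof.
apply/seteqP; split=> [f [_ cf]|_ ->].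
  by apply: PSL2Z_centralizer_trivial => g /PSL2Z_Mod; exact: cf.
split; first exact/PSL2Z_Mod/PSL2Z1.
by move=> g _; rewrite /commute mul1g mulg1.
Qed.
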